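(* Let $E$ be a compressible countable Borel equivalence relation on a standard Borel space $X$, and let $G$ be a countable group. Then every Borel action $G \curvearrowright_B X/E$ has a class-bijective lift, i.e. there is an action of $G$ on $X$ by Borel automorphisms of $E$ such that $[g\cdot x]_E = g\cdot [x]_E$ for all $g\in G$, $x\in X$, and such that for all $g\in G$, $x\in X$, $g\cdot x \mathrel{E} x$ implies $g\cdot x = x$.
   Context: A countable Borel equivalence relation (CBER) on a standard Borel space $X$ is an equivalence relation $E\subseteq X^2$ that is Borel and all of whose classes are countable. $E$ is compressible if there is a Borel injection $T:X\to X$ with $T([x]_E)\subsetneq [x]_E$ for every $x$. A function $f:X/E\to X/E$ is Borel if there is a Borel map $T:X\to X$ with $f([x]_E)=[T(x)]_E$ for all $x$. $\mathrm{Sym}_B(X/E)$ is the group of bijections $X/E\to X/E$ that are Borel with Borel inverse. A Borel action $G\curvearrowright_B X/E$ is a homomorphism $G\to \mathrm{Sym}_B(X/E)$. A Borel automorphism of $E$ is a Borel bijection $T:X\to X$ with $x\mathrel E y\iff T(x)\mathrel E T(y)$. *)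

(* Defs.v *)
From HB Require Import structures.
From mathcomp Require Import all_boot all_order all_algebra.
From mathcomp Require Import all_classical all_reals all_analysis.

Set Implicit Arguments.
Unset Strict Implicit.
Unset Printing Implicit Defensive.

Local Open Scope classical_set_scope.

(* A Hausdorff pseudometric is a metric, and completeness here is convergence of
   Cauchy filters, which for (pseudo)metrics is the same as for Cauchy sequences *)
Definition polish (R : realType) (Y : completePseudoMetricType R) : Prop :=
  hausdorff_space Y /\ exists2 S : set Y, countable S & dense S.

(* As in Kechris: isomorphic, as a measurable space, to a Polish space with its
   Borel sigma-algebra *)
Definition standard_borel (R : realType) (d : measure_display)
    (X : measurableType d) : Prop :=
  exists Y : completePseudoMetricType R, polish Y /\
  exists f : X -> Y, bijective f /\
    forall A : set Y, measurable (f @^-1` A) <-> <<s @open Y >> A.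

Definition eclass (X : Type) (E : X -> X -> Prop) (x : X) : set X :=
  [set y | E x y].

Record cber (d : measure_display) (X : measurableType d) (E : X -> X -> Prop) :
    Prop := Cber {
  cber_refl : forall x, E x x;
  cber_sym : forall x y, E x y -> E y x;
  cber_trans : forall x y z, E x y -> E y z -> E x z;
  cber_borel : measurable [set p : X * X | E p.1 p.2];
  cber_countable : forall x, countable (eclass E x)
}.

Definition compressible (d : measure_display) (X : measurableType d)
    (E : X -> X -> Prop) : Prop :=
  exists T : X -> X, [/\ measurable_fun setT T, injective T &
    forall x, T @` eclass E x `<` eclass E x].

Definition equot (X : Type) (E : X -> X -> Prop) : Type :=
  {C : set X | exists x, C = eclass E x}.

Definition to_equot (X : Type) (E : X -> X -> Prop) (x : X) : equot E :=
  exist _ (eclass E x) (ex_intro _ x erefl).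

Definition quot_borel (d : measure_display) (X : measurableType d)
    (E : X -> X -> Prop) (f : equot E -> equot E) : Prop :=
  exists2 T : X -> X, measurable_fun setT T &
    forall x, f (to_equot E x) = to_equot E (T x).

(* Membership in Sym_B(X/E) *)
Definition sym_borel (d : measure_display) (X : measurableType d)
    (E : X -> X -> Prop) (f : equot E -> equot E) : Prop :=
  quot_borel f /\
  exists f' : equot E -> equot E, [/\ cancel f f', cancel f' f & quot_borel f'].

Definition group_action (G : groupType) (Y : Type) (a : G -> Y -> Y) : Prop :=
  (forall y, a 1%g y = y) /\ forall g h y, a (g * h)%g y = a g (a h y).

Definition borel_quot_action (d : measure_display) (X : measurableType d)
    (E : X -> X -> Prop) (G : groupType) (a : G -> equot E -> equot E) : Prop :=
  group_action a /\ forall g, sym_borel (a g).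

Definition borel_automorphism (d : measure_display) (X : measurableType d)
    (E : X -> X -> Prop) (T : X -> X) : Prop :=
  [/\ measurable_fun setT T, bijective T & forall x y, E x y <-> E (T x) (T y)].

Definition class_bijective_lift (d : measure_display) (X : measurableType d)
    (E : X -> X -> Prop) (G : groupType) (a : G -> equot E -> equot E)
    (b : G -> X -> X) : Prop :=
  [/\ group_action b,
      forall g, borel_automorphism E (b g),
      forall g x, to_equot E (b g x) = a g (to_equot E x) &
      forall g x, E (b g x) x -> b g x = x].

(* Main.v *)
(** Fix Borel maps [t g] inducing the given action, and enumerate [G] with the
    identity first.  Let [W] be the set of pairs [(g, z)] such that [g] is the
    first element of [G] carrying the class of [z] to [g[z]].  The pair [(g, z)]
    is to be represented by a point of [g[z]]: compressibility supplies a Borel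
    injection [W -> X] that does so, the map [x |-> (1, x)] is an injection the
    other way, and Schroeder-Bernstein gives a Borel bijection [beta : W -> X]
    with [beta (g, z)] in [g[z]].  Then [g] acts on [X] by
    [beta (h, z) |-> beta (k, z)], where [k] is the first element carrying [z]
    to the class [gh[z]]: when [gh[z] = h[z]] this is [k = h], so the action is
    class-bijective.

    All the Borel computations rest on writing [E] as a countable union of
    graphs of Borel functions (Lusin-Novikov), which is proved in Baire space:
    if countably many Borel graphs never cover a Borel set [A] of the plane,
    then separating analytic sets yields a Cantor scheme converging to
    uncountably many points of a single vertical section of [A]. *)

Require Import Defs.
From HB Require Import structures.
From mathcomp Require Import all_boot all_order all_algebra.
From mathcomp Require Import all_classical all_reals all_analysis.
From mathcomp Require Import zify lra.

Set Implicit Arguments.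
Unset Strict Implicit.
Unset Printing Implicit Defensive.

Local Open Scope classical_set_scope.

(** * Measurability of sets and maps given by formulas *)

Section MeasurableComprehensions.
Context (d : measure_display) (T : measurableType d).
Implicit Types P Q : T -> Prop.

Lemma measurable_Pnot P : measurable [set x | P x] -> measurable [set x | ~ P x].
Proof. exact: measurableC. Qed.

Lemma measurable_Pand P Q : measurable [set x | P x] -> measurable [set x | Q x] ->
  measurable [set x | P x /\ Q x].
Proof. exact: measurableI. Qed.

Lemma measurable_Por P Q : measurable [set x | P x] -> measurable [set x | Q x] ->
  measurable [set x | P x \/ Q x].
Proof. exact: measurableU. Qed.

Lemma measurable_Pexists (I : Type) (F : I -> T -> Prop) :
  countable [set: I] -> (forall i, measurable [set x | F i x]) ->
  measurable [set x | exists i, F i x].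
Proof.
move=> cI mF; rewrite (_ : [set x | _] = \bigcup_i [set x | F i x]).
  exact: countable_bigcupT_measurable.
by apply/seteqP; split=> x [i] => [Fx|_ Fx]; exists i.
Qed.

Lemma measurable_Pforall (I : Type) (F : I -> T -> Prop) :
  countable [set: I] -> (forall i, measurable [set x | F i x]) ->
  measurable [set x | forall i, F i x].
Proof.
move=> cI mF; rewrite (_ : [set x | _] = ~` [set x | exists i, ~ F i x]).
  by apply: measurableC; apply: measurable_Pexists => // i; exact: measurable_Pnot.
apply/seteqP; split=> x /= H; first by case=> i; apply; exact: H.
by move=> i; apply: contrapT => nF; apply: H; exists i.
Qed.

Lemma measurable_Pcst (P : Prop) : measurable [set x : T | P].
Proof.
have [p|np] := pselect P.
  by rewrite (_ : [set x | P] = setT) //; apply/seteqP; split.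
by rewrite (_ : [set x | P] = set0) //; apply/seteqP; split.
Qed.

Lemma measurable_Pimply (P : Prop) Q : measurable [set x | Q x] ->
  measurable [set x | P -> Q x].
Proof.
move=> mQ; have [p|np] := pselect P.
  by rewrite (_ : [set x | P -> Q x] = [set x | Q x]) //;
    apply/seteqP; split=> x /=; [move/(_ p)|].
rewrite (_ : [set x | P -> Q x] = setT); first exact: measurableT.
by apply/seteqP; split=> x //= _ p; case: np.
Qed.

Lemma measurable_preimageT (d' : measure_display) (T' : measurableType d')
    (f : T -> T') (A : T' -> Prop) :
  measurable_fun setT f -> measurable [set y | A y] ->
  measurable [set x | A (f x)].
Proof. by move=> mf mA; rewrite -[X in measurable X]setTI; exact: mf. Qed.

(** The pieces may overlap; this is how maps built from countably many Borel choices are shown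
    Borel. *)
Lemma measurable_fun_piecewise (d' : measure_display) (T' : measurableType d')
    (I : Type) (M : I -> T -> Prop) (F : I -> T -> T') (f : T -> T') :
  countable [set: I] -> (forall i, measurable [set x | M i x]) ->
  (forall i, measurable_fun setT (F i)) -> (forall x, exists i, M i x) ->
  (forall i x, M i x -> f x = F i x) -> measurable_fun setT f.
Proof.
move=> cI mM mF cover fE _ A mA; rewrite setTI.
rewrite (_ : f @^-1` A = [set x | exists i, M i x /\ A (F i x)]).
  by apply: measurable_Pexists => // i; apply: measurable_Pand => //;
    exact: measurable_preimageT.
apply/seteqP; split=> x /=.
  by move=> Afx; have [i Mx] := cover x; exists i; rewrite -(fE i).
by move=> [i [Mx]]; rewrite (fE i).
Qed.

End MeasurableComprehensions.

(** * Analytic subsets of Baire space *)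

(** Dependent choice along finite sequences; it produces the branches of both tree arguments
    below. *)
Lemma exists_branch (T : Type) (P : seq T -> Prop) :
  P [::] -> (forall s, P s -> exists a, P (rcons s a)) ->
  exists u : nat -> T, forall n, P (mkseq u n).
Proof.
move=> P0 PS.
have [a0 _] := PS _ P0.
have /choice[c cP] : forall s, exists a, P s -> P (rcons s a).
  move=> s; have [/PS[a Pa]|nPs] := pselect (P s); first by exists a.
  by exists a0.
pose st := fix st n := if n is m.+1 then rcons (st m) (c (st m)) else [::].
have stE n : mkseq (fun n => c (st n)) n = st n.
  by elim: n => [//|n IH]; rewrite mkseqS IH.
by exists (fun n => c (st n)); elim=> [//|n IH]; rewrite stE /= -stE; exact: cP.
Qed.

(** These sets form a countable subbase of the product topology, so they generate the Borel sets of
    Baire space. *)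
Definition cylinders : set (set (nat -> nat)) :=
  [set C | exists n k, C = [set z | z n = k]].

Definition baire : Type := g_sigma_algebraType cylinders.
HB.instance Definition _ := Measurable.on baire.

Section BaireMeasurability.
Context (d : measure_display) (T : measurableType d).

Lemma measurable_fun_baire (f : T -> baire) :
  (forall n k, measurable [set x | f x n = k]) <-> measurable_fun setT f.
Proof.
split=> [mf|mf n k]; last first.
  apply: (measurable_preimageT (A := fun z : baire => z n = k)) mf _.
  by apply: sub_sigma_algebra; exists n, k.
apply: (@measurability _ _ T baire setT f cylinders) => // _ [_ [n [k ->]] <-].
by rewrite setTI; exact: mf.
Qed.

Lemma measurable_baire_eq (f g : T -> baire) :
  measurable_fun setT f -> measurable_fun setT g ->
  measurable [set x | f x = g x].
Proof.
move=> /measurable_fun_baire mf /measurable_fun_baire mg.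
rewrite (_ : [set x | _] = [set x | forall n, exists k, f x n = k /\ g x n = k]).
  apply: measurable_Pforall => // n; apply: measurable_Pexists => // k.
  exact: measurable_Pand.
apply/seteqP; split=> x /=; first by move=> -> n; exists (g x n).
by move=> H; apply/funext => n; have [k [-> ->]] := H n.
Qed.

End BaireMeasurability.

Lemma measurable_reindex (r : nat -> nat) :
  measurable_fun setT (fun z : baire => z \o r : baire).
Proof.
by apply/measurable_fun_baire => n k; apply: sub_sigma_algebra; exists (r n), k.
Qed.

Definition extends (s : seq nat) (z : baire) : Prop := mkseq z (size s) = s.

Lemma extendsP (s : seq nat) (z : baire) :
  extends s z <-> forall k, (k < size s)%N -> z k = nth 0%N s k.
Proof.
split=> [<- k|H]; first by rewrite size_mkseq => ?; rewrite nth_mkseq.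
apply: (@eq_from_nth _ 0%N); rewrite size_mkseq// => k ks.
by rewrite nth_mkseq// H.
Qed.

Lemma measurable_extends s : measurable [set z : baire | extends s z].
Proof.
rewrite (_ : [set z | _] =
  [set z : baire | forall k, (k < size s)%N -> z k = nth 0%N s k]).
  apply: measurable_Pforall => // k; apply: measurable_Pimply.
  by apply: sub_sigma_algebra; exists k, (nth 0%N s k).
by apply/seteqP; split=> z /extendsP.
Qed.

(** Closedness for the product topology, whose basic neighbourhoods of [z] are given by its initial
    segments. *)
Definition bclosed (F : set baire) : Prop :=
  forall z : baire, (forall n, exists2 w, F w & extends (mkseq z n) w) -> F z.

Lemma extends_mkseq (z w : baire) n :
  extends (mkseq z n) w <-> forall k, (k < n)%N -> w k = z k.
Proof.
rewrite extendsP size_mkseq; split=> H k kn; first by rewrite H ?nth_mkseq.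
by rewrite nth_mkseq// H.
Qed.

(** Reindexing is continuous: the first [n] coordinates of [z \o r] are read off finitely many
    coordinates of [z]. *)
Lemma bclosed_reindex (F : set baire) (r : nat -> nat) :
  bclosed F -> bclosed [set z : baire | F (z \o r)].
Proof.
move=> cF z H; apply: cF => n.
have [w Fw /extends_mkseq wz] := H (\max_(k < n) (r k)).+1.
exists (w \o r) => //; apply/extends_mkseq => k kn /=; apply: wz.
by rewrite ltnS; apply: (@leq_bigmax _ (fun i : 'I_n => r i) (Ordinal kn)).
Qed.

Lemma bclosedI (F H : set baire) : bclosed F -> bclosed H -> bclosed (F `&` H).
Proof.
by move=> cF cH z zP; split; [apply: cF|apply: cH] => n;
  have [w [Fw Hw] ?] := zP n; exists w.
Qed.

Lemma bclosed_bigcap (I : Type) (F : I -> set baire) :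
  (forall i, bclosed (F i)) -> bclosed [set z | forall i, F i z].
Proof. by move=> cF z zP i; apply: cF => n; have [w Fw ?] := zP n; exists w. Qed.

Lemma bclosed_cylinder n (K : set nat) : bclosed [set z : baire | K (z n)].
Proof.
by move=> z zP; have [w Kw /extends_mkseq wz] := zP n.+1; rewrite /= -wz.
Qed.

(* An analytic set is a projection of a closed set; letting the projection be
   an arbitrary selection of coordinates makes images and products free *)
Definition analytic (A : set baire) : Prop :=
  exists (r : nat -> nat) (F : set baire),
    bclosed F /\ A = [set z \o r | z in F].

Definition bleft (z : baire) : baire := z \o double.
Definition bright (z : baire) : baire := z \o (fun n => n.*2.+1).
Definition bjoin (x y : baire) : baire :=
  fun n => if odd n then y n./2 else x n./2.

Lemma bleft_join x y : bleft (bjoin x y) = x.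
Proof. by apply/funext => n; rewrite /bleft /bjoin /= odd_double doubleK. Qed.

Lemma bright_join x y : bright (bjoin x y) = y.
Proof.
by apply/funext => n; rewrite /bright /bjoin /= odd_double /= uphalf_double.
Qed.

(** A normal form with one fixed projection, so that countably many analytic sets can be combined:
    the odd half carries the original witness, and matching it with the even half is a closed
    condition. *)
Lemma analytic_bleft (A : set baire) : analytic A ->
  exists F : set baire, bclosed F /\ A = [set bleft z | z in F].
Proof.
move=> [r [F [cF ->]]].
exists ([set z : baire | F (bright z)] `&`
        [set z : baire | forall n, bleft z n = bright z (r n)]); split.
  apply: bclosedI; first exact: bclosed_reindex.
  apply: bclosed_bigcap => n z zP.
  have [w /= wE /extends_mkseq wz] := zP (maxn n.*2 (r n).*2.+1).+1.
  by move: wE; rewrite /bleft /bright /= !wz// ltnS ?leq_maxl ?leq_maxr.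
apply/seteqP; split=> [_ [z Fz <-]|_ [z [Fz zE] <-]].
  by exists (bjoin (z \o r) z); rewrite /= ?bleft_join ?bright_join.
exists (bright z) => //; apply/funext => n; exact/esym/zE.
Qed.

Lemma analytic_reindex (A : set baire) (r : nat -> nat) :
  analytic A -> analytic [set z \o r | z in A].
Proof.
move=> [r' [F [cF ->]]]; exists (r' \o r), F; split=> //.
by apply/seteqP; split=> [_ [_ [z Fz <-] <-]|_ [z Fz <-]];
  [exists z|exists (z \o r'); [exists z|]].
Qed.

Lemma bclosed_analytic (F : set baire) : bclosed F -> analytic F.
Proof.
by move=> cF; exists id, F; split=> //; rewrite -[LHS](image_id F).
Qed.

Lemma analyticT : analytic setT.
Proof. exact: bclosed_analytic. Qed.

Lemma analytic_bigcup (A : nat -> set baire) :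
  (forall n, analytic (A n)) -> analytic (\bigcup_n A n).
Proof.
move=> aA; have /choice[F FP] := fun n => analytic_bleft (aA n).
(* Coordinate 1 stores the index of the set; [z \o r] skips it and leaves the point on the even
   coordinates alone. *)
pose r n := if odd n then n.+2 else n.
exists double, [set z | F (z 1%N) (z \o r)]; split.
  move=> z zP; have [w1 _ /extends_mkseq w1z] := zP 2%N.
  apply: (bclosed_reindex (r := r) (FP (z 1%N)).1) => n.
  have [w /= Fw /extends_mkseq wz] := zP (maxn n 2).
  exists w; first by rewrite -(wz 1%N)// leq_max orbT.
  by apply/extends_mkseq => k kn; apply: wz; rewrite leq_max kn.
have lr (z : baire) : bleft (z \o r) = bleft z.
  by apply/funext => k; rewrite /bleft /= /r odd_double.
apply/seteqP; split=> [x [n _]|_ [z Fz <-]].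
  rewrite (FP n).2 => -[z Fz <-].
  pose w := bjoin (bleft z) (fun k => if k is j.+1 then bright z j else n).
  exists w; last by rewrite -[LHS]/(bleft w) bleft_join.
  rewrite /= (_ : w \o r = z) //; apply/funext => k.
  rewrite /r /w /bjoin /bleft /bright /=.
  by case ok: (odd k); rewrite /= ?negbK ok /=; congr (z _); lia.
by exists (z 1%N) => //; rewrite (FP _).2; exists (z \o r); rewrite // lr.
Qed.

Lemma analytic_bigcap (A : nat -> set baire) :
  (forall n, analytic (A n)) -> analytic (\bigcap_n A n).
Proof.
move=> aA; have /choice[F FP] := fun n => analytic_bleft (aA n).
(* All witnesses share the odd half: the pair [(n, k)] addresses coordinate [k] of the odd half of
   the [n]-th one. *)
pose r (n k : nat) := if odd k then (choice.pickle (n, k./2)).*2.+1 else k.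
exists double, [set z : baire | forall n, F n (z \o r n)]; split.
  by apply: bclosed_bigcap => n; apply: bclosed_reindex; exact: (FP n).1.
have lr n (z : baire) : bleft (z \o r n) = bleft z.
  by apply/funext => k; rewrite /bleft /= /r odd_double.
apply/seteqP; split=> [x Ax|_ [z Fz <-] n _]; last first.
  by rewrite (FP _).2; exists (z \o r n); rewrite // lr.
have /choice[w wP] : forall n, exists w, F n w /\ bleft w = x.
  by move=> n; have := Ax n I; rewrite (FP n).2 => -[w Fw wx]; exists w.
pose y j := if choice.unpickle j is Some (n, k) then bright (w n) k else 0%N.
exists (bjoin x y); last exact: bleft_join.
move=> n /=; rewrite (_ : bjoin x y \o r n = w n); first exact: (wP n).1.
apply/funext => k; rewrite /r /bjoin /=; case ok: (odd k).
  rewrite /= odd_double /= uphalf_double /y choice.pickleK /bright /=.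
  by congr (w n _); lia.
by rewrite ok -(wP n).2 /bleft /=; congr (w n _); lia.
Qed.

Lemma analytic_forall (I : countType) (A : I -> set baire) :
  (forall i, analytic (A i)) -> analytic [set x | forall i, A i x].
Proof.
move=> aA.
rewrite (_ : [set x | _] = \bigcap_n oapp A setT (choice.unpickle n)).
  by apply: analytic_bigcap => n; case: choice.unpickle => /=;
    [move=> i|]; [exact: aA|exact: analyticT].
apply/seteqP; split=> x Ax => [n _|i].
  by case: choice.unpickle => //= i; exact: Ax.
by have := Ax (choice.pickle i) Logic.I; rewrite choice.pickleK.
Qed.

Lemma analyticI (A B : set baire) : analytic A -> analytic B -> analytic (A `&` B).
Proof.
move=> aA aB; rewrite (_ : A `&` B = \bigcap_n (if n == 0%N then A else B)).
  by apply: analytic_bigcap => n; case: ifP.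
apply/seteqP; split=> [x [Ax Bx] n _|x H]; first by case: ifP.
by split; [exact: (H 0%N I)|exact: (H 1%N I)].
Qed.

(** Analyticity does not pass to complements, so the induction runs over sets that are analytic
    together with their complement. *)
Lemma measurable_analytic (A : set baire) : measurable A -> analytic A.
Proof.
suff : <<s cylinders >> `<=` [set A : set baire | analytic A /\ analytic (~` A)].
  by move=> H /H[].
apply: smallest_sub; last first.
  move=> _ [n [k ->]]; split; apply: bclosed_analytic.
    exact: (@bclosed_cylinder n [set k]).
  exact: (@bclosed_cylinder n (~` [set k])).
split.
- split; apply: bclosed_analytic; first by move=> z /(_ 0%N)[].
  by move=> z _ [].
- by move=> B [aB aCB]; rewrite /= setTD setCK.
- move=> B aB; split; first by apply: analytic_bigcup => n; exact: (aB n).1.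
  by rewrite setC_bigcup; apply: analytic_bigcap => n; exact: (aB n).2.
Qed.

(** * Separation of disjoint analytic sets by Borel sets *)

Definition borel_separated (A B : set baire) : Prop :=
  exists C : set baire, [/\ measurable C, A `<=` C & B `&` C = set0].

Lemma borel_separated_bigcup (A B : nat -> set baire) :
  (forall m n, borel_separated (A m) (B n)) ->
  borel_separated (\bigcup_n A n) (\bigcup_n B n).
Proof.
move=> AB.
have /choice[C CP] : forall mn : nat * nat, exists C : set baire,
    [/\ measurable C, A mn.1 `<=` C & B mn.2 `&` C = set0].
  by move=> [m n]; exact: AB.
exists [set x | exists m, forall n, C (m, n) x]; split.
- apply: measurable_Pexists => // m; apply: measurable_Pforall => // n.
  by case: (CP (m, n)).
- by move=> x [m _ Ax]; exists m => n; case: (CP (m, n)) => _ + _; apply.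
- apply/seteqP; split=> // x [[n _ Bx] [m /(_ n) Cx]].
  by case: (CP (m, n)) => _ _ <-; split.
Qed.

(** Splitting both sets by one more coordinate of their witnesses keeps some pair of pieces
    unseparated. Along a branch of such pairs the witnesses converge to [z] in [F] and [w] in [F'];
    their projections differ by disjointness, and a single cylinder then separates late pieces, a
    contradiction. *)
Theorem analytic_separation (A B : set baire) :
  analytic A -> analytic B -> A `&` B = set0 -> borel_separated A B.
Proof.
move=> [r [F [cF ->]]] [r' [F' [cF' ->]]] AB0; apply: contrapT => nsep.
pose S (r : nat -> nat) (F : set baire) s := [set z \o r | z in F `&` extends s].
have SU r0 (F0 : set baire) s : S r0 F0 s = \bigcup_a S r0 F0 (rcons s a).
  apply/seteqP; split=> [_ [z [Fz sz] <-]|_ [a _ [z [Fz sz] <-]]].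
    exists (z (size s)) => //; exists z => //; split => //.
    by rewrite /extends size_rcons mkseqS sz.
  exists z => //; split => //; move: sz.
  by rewrite /extends size_rcons mkseqS => /rcons_inj[].
pose P (l : seq (nat * nat)) :=
  ~ borel_separated (S r F (unzip1 l)) (S r' F' (unzip2 l)).
have S0 r0 (F0 : set baire) : S r0 F0 [::] = [set z \o r0 | z in F0].
  by apply/seteqP; split=> [_ [z [Fz _] <-]|_ [z Fz <-]]; exists z.
have [||u Pu] := @exists_branch _ P; first by rewrite /P /= !S0.
  move=> l Pl; apply: contrapT => nex; apply: Pl; rewrite !SU.
  apply: borel_separated_bigcup => m n; apply: contrapT => nmn; apply: nex.
  by exists (m, n); rewrite /P /unzip1 /unzip2 !map_rcons.
pose z : baire := fun n => (u n).1; pose w : baire := fun n => (u n).2.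
have {}Pu n : ~ borel_separated (S r F (mkseq z n)) (S r' F' (mkseq w n)).
  have := Pu n; rewrite /P /unzip1 /unzip2 /mkseq -!map_comp.
  by rewrite (eq_map (_ : _ =1 z))// (eq_map (_ : _ =1 w)).
(* Otherwise some left piece is empty, and [set0] separates it from anything. *)
have Fz : F z.
  apply: cF => n; apply: contrapT => nex; apply: (Pu n); exists set0.
  split; rewrite ?setI0// => _ [v [Fv vz] <-].
  by apply: nex; exists v.
have Fw : F' w.
  apply: cF' => n; apply: contrapT => nex; apply: (Pu n); exists setT.
  split; rewrite ?setIT//; apply/seteqP; split=> // _ [v [Fv vz] <-].
  by apply: nex; exists v.
have [m zw] : exists m, z (r m) <> w (r' m).
  apply: contrapT => nex; suff : set0 (z \o r : baire) by [].
  rewrite -AB0; split; first by exists z.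
  exists w => //; apply/funext => m /=; apply: contrapT => ne.
  by apply: nex; exists m => /esym.
(* Past this length every witness agrees with [z] at [r m], respectively with [w] at [r' m]. *)
apply: (Pu (maxn (r m) (r' m)).+1); exists [set x : baire | x m = z (r m)]; split.
- by apply: sub_sigma_algebra; exists m, (z (r m)).
- by move=> _ [v [_ /extends_mkseq vz] <-]; apply: vz; rewrite ltnS leq_maxl.
- apply/seteqP; split=> // _ [[v [_ /extends_mkseq vw] <-]] /= vz.
  by apply: zw; rewrite -vz vw// ltnS leq_maxr.
Qed.

(** * The Lusin-Novikov theorem *)

(** Borel choice of an index, with value 0 where none exists. At most one [k] satisfies [Q k x], so
    each fibre of [n] has an explicit Borel formula. *)
Lemma measurable_least (d : measure_display) (T : measurableType d)
    (P : nat -> T -> Prop) :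
  (forall k, measurable [set x | P k x]) ->
  exists n : T -> nat, (forall x, (exists k, P k x) -> P (n x) x) /\
    forall k, measurable [set x | n x = k].
Proof.
move=> mP.
pose Q k x := (P k x /\ forall j, (j < k)%N -> ~ P j x) \/
  (k = 0%N /\ forall j, ~ P j x).
have /choice[n nP] : forall x, exists k, Q k x.
  move=> x; have [[k Pk]|nP] := pselect (exists k, P k x); last first.
    by exists 0%N; right; split=> // j Pj; apply: nP; exists j.
  have exP : exists k, `[< P k x >] by exists k; exact/asboolP.
  case: (ex_minnP exP) => m /asboolP Pm mmin; exists m; left; split=> // j jm Pj.
  by have := mmin j (asboolT Pj); rewrite leqNgt jm.
have Quniq j k x : Q j x -> Q k x -> j = k.
  move=> [[Pj jmin]|[-> nPj]] [[Pk kmin]|[-> nPk]] //.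
  - by have [/kmin|/jmin|//] := ltngtP j k.
  - by have := nPk j.
  - by have := nPj k.
exists n; split=> [x [k Pk]|k]; first by case: (nP x) => [[]//|[_ /(_ k)]].
rewrite (_ : [set x | _] = [set x | Q k x]); last first.
  by apply/seteqP; split=> x /= => [<-//|]; exact: Quniq.
rewrite /Q; apply: measurable_Por; apply: measurable_Pand.
- exact: mP.
- by apply: measurable_Pforall => // j; apply: measurable_Pimply;
    exact: measurable_Pnot.
- exact: measurable_Pcst.
- by apply: measurable_Pforall => // j; exact: measurable_Pnot.
Qed.

(** By functionality, the points [z \o p] with [z (q m) = k] and those with [z (q m) <> k] form
    disjoint analytic sets. Over the projection of [S], only the right [k] puts the point into the
    separating set [B (m, k)]. *)
Lemma functional_analytic_graph (S : set baire) (p q : nat -> nat) :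
  analytic S ->
  (forall z w : baire, S z -> S w -> z \o p = w \o p -> z \o q = w \o q) ->
  exists g : baire -> baire, measurable_fun setT g /\
    forall z, S z -> z \o q = g (z \o p).
Proof.
move=> aS Sfun.
pose img (K : set baire) : set baire := [set z \o p | z in S `&` K].
have /choice[B BP] : forall mk : nat * nat,
    exists B : set baire, [/\ measurable B, img [set z | z (q mk.1) = mk.2] `<=` B &
      img [set z | z (q mk.1) <> mk.2] `&` B = set0].
  move=> [m k]; have mqk : measurable [set z : baire | z (q m) = k].
    by apply: sub_sigma_algebra; exists (q m), k.
  apply: analytic_separation.
  - exact/analytic_reindex/analyticI/measurable_analytic.
  - apply/analytic_reindex/analyticI/measurable_analytic => //.
    exact: measurable_Pnot.
  apply/seteqP; split=> // _ [[z [Sz /= zk] <-] [w [Sw /= wk] wz]].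
  by have /(congr1 (fun u : baire => u m)) := Sfun _ _ Sw Sz wz; rewrite /= zk.
have /choice[g gP] : forall m, exists n : baire -> nat,
    (forall x, (exists k, B (m, k) x) -> B (m, n x) x) /\
    forall k, measurable [set x | n x = k].
  by move=> m; apply: measurable_least => k; case: (BP (m, k)).
exists (fun x m => g m x); split.
  by apply/measurable_fun_baire => m k; exact: (gP m).2.
move=> z Sz; apply/funext => m /=; apply: contrapT => ne.
have Bz : B (m, g m (z \o p)) (z \o p).
  apply: (gP m).1; exists (z (q m)); case: (BP (m, z (q m))) => _ + _; apply.
  by exists z.
suff : set0 (z \o p : baire) by [].
by case: (BP (m, g m (z \o p))) => _ _ <-; split=> //; exists z.
Qed.

Lemma measurable_bright : measurable_fun setT bright.
Proof. exact: measurable_reindex. Qed.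

Lemma measurable_bleft : measurable_fun setT bleft.
Proof. exact: measurable_reindex. Qed.

(** * Cantor schemes for the plane set of points [(z \o p, z \o q)] with [z] in a closed [Z] *)

Section LusinNovikov.
Variables (Z : set baire) (p q : nat -> nat).
Hypothesis closedZ : bclosed Z.

(* Over some point [x], each cylinder in [L] keeps a point of [Z] that is not
   removed by the countably many Borel graphs [g n] *)
Definition alive (L : set (seq nat)) : Prop :=
  forall g : nat -> baire -> baire, (forall n, measurable_fun setT (g n)) ->
  exists x : baire, forall s, L s ->
  exists z : baire, [/\ Z z, extends s z, z \o p = x & forall n, z \o q <> g n x].

Lemma alive_sub (L M : set (seq nat)) : L `<=` M -> alive M -> alive L.
Proof.
by move=> LM aM g mg; have [x xP] := aM g mg; exists x => s /LM; exact: xP.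
Qed.

(** The disagreement is at a coordinate seen by [q], so points extending [s1] and [s2] have
    different second coordinates [z \o q]. *)
Definition splits (s s1 s2 : seq nat) : Prop :=
  [/\ prefix s s1, prefix s s2 & exists m, [/\ (q m < size s1)%N,
      (q m < size s2)%N & nth 0%N s1 (q m) <> nth 0%N s2 (q m)]].

Lemma splits_mkseq (s : seq nat) (z w : baire) :
  extends s z -> extends s w -> z \o q <> w \o q ->
  exists s1 s2, [/\ splits s s1 s2, extends s1 z & extends s2 w].
Proof.
move=> sz sw zw.
have [m zwm] : exists m, z (q m) <> w (q m).
  apply: contrapT => nex; apply: zw; apply/funext => m; apply: contrapT => ne.
  by apply: nex; exists m.
pose N := maxn (size s) (q m).+1.
have pre (u : baire) : extends s u -> prefix s (mkseq u N).
  move=> su; rewrite -{1}su prefixE size_mkseq /mkseq -map_take take_iota.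
  by rewrite (minn_idPl _)// leq_maxl.
have qN : (q m < N)%N by rewrite leq_max leqnn orbT.
exists (mkseq z N), (mkseq w N); split; try exact/extends_mkseq.
split; try exact: pre.
by exists m; rewrite !size_mkseq !nth_mkseq.
Qed.

Lemma measurable_removed (g : nat -> baire -> baire) :
  (forall n, measurable_fun setT (g n)) ->
  measurable [set z : baire | forall n, z \o q <> g n (z \o p)].
Proof.
move=> mg; apply: measurable_Pforall => // n; apply: measurable_Pnot.
apply: measurable_baire_eq; first exact: measurable_reindex.
exact: (measurableT_comp (mg n) (measurable_reindex p)).
Qed.

(** If no splitting of [s] stays alive, each pair [(s1, s2)] comes with Borel graphs refuting it,
    and these merge into one countable family [g] with survivors [U]. Then the set [B] of points
    over which all of [L] survives is disjoint from the set [D] of points over which [s] has two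
    survivors with different [z \o q]. Separating them makes the survivors in [s] a functional
    analytic graph over a Borel set containing [B]; removing that graph too contradicts
    [alive L]. *)
Lemma alive_split (L : set (seq nat)) s : alive L -> L s ->
  exists s1 s2, splits s s1 s2 /\ alive (L `|` [set s1; s2]).
Proof.
move=> aL Ls; apply: contrapT => nex.
have /choice[G GP] : forall st : seq nat * seq nat,
    exists g : nat -> baire -> baire, (forall n, measurable_fun setT (g n)) /\
    (splits s st.1 st.2 -> ~ exists x : baire, forall t,
      (L `|` [set st.1; st.2]) t -> exists z : baire,
      [/\ Z z, extends t z, z \o p = x & forall n, z \o q <> g n x]).
  move=> [s1 s2] /=; have [sp|nsp] := pselect (splits s s1 s2); last first.
    by exists (fun _ => id); split.
  apply: contrapT => nG; apply: nex; exists s1, s2; split => // g mg.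
  by apply: contrapT => ng; apply: nG; exists g; split.
pose g n : baire -> baire :=
  if choice.unpickle n is Some (st, k) then G st k else id.
have mg n : measurable_fun setT (g n).
  by rewrite /g; case: choice.unpickle => [[st k]|//]; exact: (GP st).1.
have gG st k : exists n, g n = G st k.
  by exists (choice.pickle (st, k)); rewrite /g choice.pickleK.
pose U := [set z : baire | forall n, z \o q <> g n (z \o p)].
have mU : measurable U by exact: measurable_removed.
pose At t : set baire := [set z \o p | z in Z `&` (extends t `&` U)].
have aZ := bclosed_analytic closedZ.
have aAt t : analytic (At t).
  apply/analytic_reindex/analyticI/measurable_analytic => //.
  exact: (measurableI _ _ (measurable_extends t) mU).
(* Sequences outside [L] contribute [setT], which makes this an intersection over the countable type
   of all sequences. *)
pose B : set baire :=
  [set x | forall t, (if `[< L t >] then At t else setT) x].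
have aB : analytic B.
  by apply: analytic_forall => t; case: ifP => _ //; exact: analyticT.
have BP x : (forall t, L t -> At t x) -> B x.
  by move=> H t; case: ifPn => // /asboolP; exact: H.
have BE x t : B x -> L t -> At t x.
  by move=> /(_ t) + /asboolP Lt; rewrite Lt.
(* A point of [D2] interleaves two survivors in [s] with equal first and different second
   coordinates. *)
pose D2 : set baire := [set w | Z (bleft w)] `&` ([set w | Z (bright w)] `&`
  ([set w | extends s (bleft w)] `&` [set w | extends s (bright w)] `&`
  [set w | U (bleft w)] `&` [set w | U (bright w)] `&`
  [set w | bleft w \o p = bright w \o p] `&`
  [set w | bleft w \o q <> bright w \o q])).
have mreindex (h : baire -> baire) r : measurable_fun setT h ->
    measurable_fun setT (fun w => h w \o r : baire).
  by move=> mh; exact: (measurableT_comp (measurable_reindex r) mh).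
pose D : set baire := [set w \o (double \o p) | w in D2].
have aD : analytic D.
  apply/analytic_reindex/analyticI.
    exact: (bclosed_analytic (bclosed_reindex (r := double) closedZ)).
  apply: analyticI.
    exact: (bclosed_analytic (bclosed_reindex (r := fun n => n.*2.+1) closedZ)).
  have ml := measurable_bleft; have mr := measurable_bright.
  apply: measurable_analytic; repeat apply: measurableI.
  - exact: (measurable_preimageT (A := extends s) ml (measurable_extends s)).
  - exact: (measurable_preimageT (A := extends s) mr (measurable_extends s)).
  - exact: (measurable_preimageT (A := U) ml).
  - exact: (measurable_preimageT (A := U) mr).
  - by apply: measurable_baire_eq; exact: mreindex.
  - by apply/measurable_Pnot/measurable_baire_eq; exact: mreindex.
have [C [mC BC DC]] : borel_separated B D.
  apply: analytic_separation => //; apply/seteqP; split=> // x.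
  move=> [Bx [w [Zl [Zr [[[[[sl sr] Ul] Ur] pE] qE]]] wx]].
  have [s1 [s2 [sp s1l s2r]]] := splits_mkseq sl sr qE.
  apply: (GP (s1, s2)).2 => //=; exists x => t Lt.
  have xl : bleft w \o p = x by rewrite -wx.
  have xr : bright w \o p = x by rewrite -pE.
  have UG (z : baire) : U z -> z \o p = x ->
      forall n, z \o q <> G (s1, s2) n x.
    by move=> Uz zx n; have [m <-] := gG (s1, s2) n; rewrite -zx; exact: Uz.
  case: Lt => [Lt|[->|->]].
  + have [z [Zz [tz Uz]] zx] := BE _ _ Bx Lt.
    by exists z; split=> //; exact: UG.
  + by exists (bleft w); split=> //; exact: UG.
  + by exists (bright w); split=> //; exact: UG.
pose S := Z `&` (extends s `&` U `&` [set z : baire | C (z \o p)]).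
have [|z w|g0 [mg0 g0P]] := @functional_analytic_graph S p q.
- apply: analyticI => //; apply: measurable_analytic; repeat apply: measurableI => //.
    exact: measurable_extends.
  exact: (measurable_preimageT (A := C) (measurable_reindex p) mC).
- move=> [Zz [[sz Uz] Cz]] [Zw [[sw Uw] Cw]] pE; apply: contrapT => qE.
  suff : set0 (z \o p : baire) by [].
  rewrite -DC; split=> //; exists (bjoin z w); last first.
    by rewrite -[in RHS](bleft_join z w).
  by rewrite /D2 /= bleft_join bright_join.
have [|x xP] := aL (fun n => if n is m.+1 then g m else g0); first by case.
have Bx : B x.
  apply: BP => t /xP[z [Zz tz zx ng]]; exists z => //; split=> //; split=> // n.
  by rewrite zx; exact: (ng n.+1).
have [z [Zz sz zx ng]] := xP _ Ls.
apply: (ng 0%N); rewrite -zx; apply: g0P; split=> //; split.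
  by split=> // n; rewrite zx; exact: (ng n.+1).
by rewrite /= zx; exact: BC.
Qed.

(* Nodes are numbered as in a binary heap: [u k] holds the two children
   [2k+1] and [2k+2] of node [k] *)
Definition heap_node (u : nat -> seq nat * seq nat) (k : nat) : seq nat :=
  if k is j.+1 then (if odd j then (u j./2).2 else (u j./2).1) else [::].

Lemma eq_heap_node u v k : (forall j, (j.*2 < k)%N -> u j = v j) ->
  heap_node u k = heap_node v k.
Proof.
by case: k => [//|k] uv /=; rewrite uv// ltnS -{2}(odd_double_half k) leq_addl.
Qed.

(** Nodes are split in heap order by [alive_split]: after [n] splits the nodes up to [n.*2] are
    defined, without reading the default [d], and jointly alive. *)
Lemma alive_heap : alive [set [::]] -> exists u : nat -> seq nat * seq nat,
  (forall n, alive [set heap_node u k | k in [set k | (k <= n)%N]]) /\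
  (forall k, splits (heap_node u k) (u k).1 (u k).2).
Proof.
move=> a0; pose d : seq nat * seq nat := ([::], [::]).
pose nodes u n := [set heap_node u k | k in [set k | (k <= n)%N]].
pose P l := alive (nodes (nth d l) (size l).*2) /\
  forall k, (k < size l)%N ->
    splits (heap_node (nth d l) k) (nth d l k).1 (nth d l k).2.
have [||u uP] := @exists_branch _ P.
- split=> //; apply: alive_sub a0 => _ [[|k] kl <-] //.
- move=> l [al sl].
  have := alive_split (s := heap_node (nth d l) (size l)) al.
  case; first by exists (size l) => //=; rewrite -addnn leq_addr.
  move=> s1 [s2 [sp al']]; exists (s1, s2).
  have nodeE k : (k <= (size l).*2)%N ->
      heap_node (nth d (rcons l (s1, s2))) k = heap_node (nth d l) k.
    by move=> kl; apply: eq_heap_node => j jk; rewrite nth_rcons;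
      have -> : (j < size l)%N by lia.
  split.
    apply: alive_sub al' => _ [k kl <-].
    have {}kl : (k <= (size l).*2.+2)%N by move: kl; rewrite size_rcons.
    have [{}kl|lk] := leqP k (size l).*2.
      by left; exists k => //; rewrite nodeE.
    right; have [->|->] : k = (size l).*2.+1 \/ k = (size l).*2.+2 by lia.
    + by left; rewrite /= odd_double doubleK nth_rcons ltnn eqxx.
    + by right; rewrite /= odd_double /= uphalf_double nth_rcons ltnn eqxx.
  move=> k; rewrite size_rcons ltnS leq_eqVlt => /orP[/eqP->|kl].
    by rewrite nodeE ?nth_rcons ?ltnn ?eqxx//; lia.
  by rewrite nodeE ?nth_rcons ?kl; [exact: sl|lia].
have nodeE n k : (k <= n.*2)%N ->
    heap_node (nth d (mkseq u n)) k = heap_node u k.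
  by move=> kn; apply: eq_heap_node => j jk; rewrite nth_mkseq//; lia.
exists u; split=> [n|k].
  have [+ _] := uP n; rewrite size_mkseq; apply: alive_sub => _ [k kn <-].
  by exists k; rewrite /= ?nodeE//; move: kn => /=; lia.
have [_ /(_ k)] := uP k.+1; rewrite size_mkseq nth_mkseq// nodeE; last by lia.
by apply.
Qed.

Lemma prefix_chain_limit (s : nat -> seq nat) :
  (forall n, prefix (s n) (s n.+1)) -> (forall n, (n <= size (s n))%N) ->
  exists z : baire, forall n, extends (s n) z.
Proof.
move=> ps ss.
have chain m n : (m <= n)%N -> prefix (s m) (s n).
  move=> /subnKC <-; elim: (n - m)%N => [|k IH]; rewrite ?addn0 ?prefix_refl//.
  by rewrite addnS; exact: prefix_trans IH (ps _).
have nthE m n j : (m <= n)%N -> (j < size (s m))%N ->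
    nth 0%N (s n) j = nth 0%N (s m) j.
  by move=> /chain /prefixP[t ->] jm; rewrite nth_cat jm.
(* [s j.+1] has length at least [j.+1], so its entry [j] is not the default of [nth]. *)
exists (fun j => nth 0%N (s j.+1) j) => n; apply/extendsP => j jn.
have [jn'|nj] := leqP j.+1 n; first by rewrite -(nthE _ n _ jn').
by rewrite (nthE n j.+1) // ltnW.
Qed.

(** [s1] and [s2] coincide on [s], so their disagreement lies beyond it. *)
Lemma splits_size s s1 s2 : splits s s1 s2 ->
  (size s < size s1)%N /\ (size s < size s2)%N.
Proof.
move=> [/prefixP[t1 ->] /prefixP[t2 ->] [m [m1 m2]]].
have [ms|sm _] := ltnP (q m) (size s); first by rewrite !nth_cat ms.
by split; apply: leq_ltn_trans sm _.
Qed.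

(** Limits of branches of the heap lie in [Z] by closedness, and they share one first coordinate
    because any two nodes contain points over a common [x]. Diagonalising against an enumeration [Y]
    of the countable section over it gives a branch whose second coordinate is not listed. *)
Lemma not_alive_countable :
  (forall x : baire, countable [set z \o q | z in [set z | Z z /\ z \o p = x]]) ->
  ~ alive [set [::]].
Proof.
move=> cZ /alive_heap[u [au su]].
(* The turn may depend on the current node, as the diagonal branch requires. *)
pose path (b : nat -> nat -> bool) :=
  fix path n := if n is m.+1 then ((path m).*2 + b m (path m)).+1 else 0%N.
have pathS b n : heap_node u (path b n.+1) =
    if b n (path b n) then (u (path b n)).2 else (u (path b n)).1.
  rewrite /= oddD odd_double /=; case: (b _ _) => /=.
    by rewrite addn1 /= uphalf_double.
  by rewrite addn0 doubleK.
have node_size b n : (n <= size (heap_node u (path b n)))%N.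
  elim: n => [//|n IH]; rewrite pathS; apply: leq_ltn_trans IH _.
  by have [? ?] := splits_size (su (path b n)); case: (b _ _).
pose lim b (z : baire) := forall n, extends (heap_node u (path b n)) z.
have lim_ex b : exists z, lim b z.
  apply: prefix_chain_limit => n; last exact: node_size.
  by rewrite pathS; have [? ? _] := su (path b n); case: (b _ _).
have lim_agree b z w n k : lim b z -> extends (heap_node u (path b n)) w ->
    (k < n)%N -> w k = z k.
  move=> /(_ n)/extendsP bz /extendsP bw kn.
  by rewrite bz ?bw//; exact: leq_trans kn (node_size _ _).
have node_alive b c n : exists x : baire,
    (exists w : baire, [/\ Z w, extends (heap_node u (path b n)) w & w \o p = x]) /\
    (exists w : baire, [/\ Z w, extends (heap_node u (path c n)) w & w \o p = x]).
  (* Only a common base point is wanted, so any Borel family may be removed. *)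
  have [|x xP] := au (maxn (path b n) (path c n)) (fun _ => id); first by [].
  exists x; split.
    have [|w [? ? ? _]] := xP (heap_node u (path b n)); last by exists w.
    by exists (path b n) => //=; rewrite leq_maxl.
  have [|w [? ? ? _]] := xP (heap_node u (path c n)); last by exists w.
  by exists (path c n) => //=; rewrite leq_maxr.
have limZ b z : lim b z -> Z z.
  move=> bz; apply: closedZ => n; have [x [[w [Zw bw _]] _]] := node_alive b b n.
  by exists w => //; apply/extends_mkseq => k; exact: lim_agree bz bw.
have lim_p b c z w : lim b z -> lim c w -> z \o p = w \o p.
  move=> bz cw; apply/funext => m /=.
  have [x [[z' [_ bz' zx]] [w' [_ cw' wx]]]] := node_alive b c (p m).+1.
  rewrite -(lim_agree _ _ _ _ _ bz bz')// -(lim_agree _ _ _ _ _ cw cw')//.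
  by have /(congr1 (fun v : baire => v m)) : z' \o p = w' \o p by rewrite zx wx.
have [z0 z0P] := lim_ex (fun _ _ => false).
have /countable_injP[f finj] := cZ (z0 \o p).
(* [Y n] is the point of the section with code [n], or the dummy [z0] if there is none. *)
have /choice[Y YP] : forall n, exists y : baire, forall z : baire,
    Z z -> z \o p = z0 \o p -> f (z \o q) = n -> z \o q = y.
  move=> n; have [[z [Zz zp zn]]|nex] := pselect (exists z : baire,
      [/\ Z z, z \o p = z0 \o p & f (z \o q) = n]); last first.
    by exists z0 => z *; case: nex; exists z.
  exists (z \o q) => w Zw wp wn; apply: finj; rewrite ?inE ?wn//.
    by exists w.
  by exists z.
(* At stage [n], turn right exactly when the left child is compatible with [Y n]; by [splits] the
   right child is then incompatible with it. *)
pose b n k := `[< forall m, (q m < size (u k).1)%N ->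
                   Y n m = nth 0%N (u k).1 (q m) >].
have [z bz] := lim_ex b.
have zp := lim_p _ _ _ _ bz z0P.
pose n := f (z \o q).
have Yn : z \o q = Y n by exact: YP (limZ _ _ bz) zp _.
have := bz n.+1; rewrite pathS; case: ifPn => [/asboolP H|/asboolP H] /extendsP ez.
  have [_ _ [m [m1 m2]]] := su (path b n).
  by apply; rewrite -ez// -H// -Yn.
by apply: H => m mu; rewrite -ez// -Yn.
Qed.

End LusinNovikov.

(** Write [A] as a projection of a closed [Z]. Countable sections prevent the root from being alive;
    as the empty sequence constrains nothing, a family witnessing this covers [A]. *)
Theorem Lusin_Novikov (A : set (baire * baire)) :
  measurable A -> (forall x, countable [set y | A (x, y)]) ->
  exists g : nat -> baire -> baire, (forall n, measurable_fun setT (g n)) /\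
    forall x y, A (x, y) -> exists n, y = g n x.
Proof.
move=> mA cA.
have : analytic [set w | A (bleft w, bright w)].
  apply: measurable_analytic.
  apply: (measurable_preimageT (A := A) (f := fun w => (bleft w, bright w))) mA.
  exact: measurable_fun_pair measurable_bleft measurable_bright.
move=> [r [Z [cZ AE]]].
have ZA (z : baire) : Z z -> A (z \o (r \o double), z \o (r \o (fun n => n.*2.+1))).
  by move=> Zz; have : [set w | A (bleft w, bright w)] (z \o r);
    [rewrite AE; exists z|].
have /existsNP[g /not_implyP[mg nx]] :
    ~ alive Z (r \o double) (r \o (fun n => n.*2.+1)) [set [::]].
  apply: not_alive_countable => // x; apply: sub_countable (cA x).
  by apply: subset_card_le => _ [z [Zz <-] <-]; exact: ZA.
exists g; split=> // x y Axy; apply: contrapT => nn; apply: nx; exists x => _ ->.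
have : [set w | A (bleft w, bright w)] (bjoin x y) by rewrite /= bleft_join bright_join.
rewrite AE => -[z Zz zE]; exists z; split=> //.
  by rewrite -[RHS](bleft_join x y) -zE.
move=> n ny; apply: nn; exists n.
by rewrite -ny -[LHS](bright_join x y) -zE.
Qed.

(** * Coding standard Borel spaces in Baire space *)

Lemma countable_range (T : Type) (A : set T) (a : T) : countable A ->
  exists u : nat -> T, A `<=` range u.
Proof.
move=> /countable_injP[f finj].
have /choice[u uP] : forall n, exists y, forall x, A x -> f x = n -> y = x.
  move=> n; have [[y [Ay yn]]|nex] := pselect (exists y, A y /\ f y = n).
    by exists y => x Ax xn; apply: finj; rewrite ?inE ?xn.
  by exists a => x Ax xn; case: nex; exists x.
by exists u => x Ax; exists (f x) => //; exact: uP.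
Qed.

Lemma measurable_baire_coord n (P : nat -> Prop) :
  measurable [set z : baire | P (z n)].
Proof.
rewrite (_ : [set z | _] = [set z : baire | exists k, z n = k /\ P k]).
  apply: measurable_Pexists => // k; apply: measurable_Pand.
    by apply: sub_sigma_algebra; exists n, k.
  exact: measurable_Pcst.
by apply/seteqP; split=> z /= => [Pz|[k [-> //]]]; exists (z n).
Qed.

Section PolishCoding.
Import Order.TTheory GRing.Theory Num.Theory.
Local Open Scope ring_scope.
Variables (R : realType) (Y : completePseudoMetricType R).

Let e (k : nat) : R := k.+1%:R^-1.

Let e_gt0 k : 0 < e k.
Proof. by rewrite /e invr_gt0. Qed.

Let e_small (eps : R) : 0 < eps -> exists k, e k < eps.
Proof.
by move=> eps0; have [N _ NP] := near_infty_natSinv_lt (PosNum eps0); exists N;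
  exact: NP (leqnn N).
Qed.

Let e_le k l : (k <= l)%N -> e l <= e k.
Proof. by move=> kl; rewrite /e lef_pV2 ?posrE// ler_nat ltnS. Qed.

(** Later centres lie within [2 * e k] of [u k], and the limit costs another [e k]. The hypothesis
    concerns two centres at a time, which keeps it Borel in a code. *)
Lemma pairwise_meeting_limit (u : nat -> Y) :
  (forall k l, exists w, ball (u k) (e k) w /\ ball (u l) (e l) w) ->
  exists y, forall k, ball (u k) (3 * e k) y.
Proof.
move=> uw.
have near_u k l : (k <= l)%N -> ball (u k) (2 * e k) (u l).
  move=> kl; have [w [wk wl]] := uw k l.
  apply: (le_ball (e1 := e k + e l)); last exact: ball_triangle wk (ball_sym wl).
  by have := e_le kl; lra.
have : cauchy (u @ \oo).
  apply: cauchy_exP => eps eps0.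
  have [|k ek] := @e_small (eps / 2); first by rewrite divr_gt0.
  exists (u k); exists k => // l /= kl.
  by apply: le_ball (near_u _ _ kl); lra.
move=> /cauchy_cvg/cvg_ex[y uy]; exists y => k.
have [N _ NP] := cvg_ball uy (e_gt0 k).
have yl := NP (maxn N k) (leq_maxl N k).
apply: (le_ball (e1 := 2 * e k + e k)); first by lra.
exact: ball_triangle (near_u _ _ (leq_maxr N k)) (ball_sym yl).
Qed.

(** Interiors are taken because a ball need not be open, while the coding needs Borel sets. *)
Lemma dense_interior_cover (u : nat -> Y) : dense (range u) ->
  forall y (eps : R), 0 < eps -> exists j, (ball (u j) eps)^° y.
Proof.
move=> du y eps eps0; have eps20 : 0 < eps / 2 by rewrite divr_gt0.
have [|w [/interior_subset yu [j _ uj]]] := du (ball y (eps / 2))^° _ (open_interior _).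
  by exists y; exact: nbhsx_ballx.
exists j; rewrite -uj in yu; apply/nbhs_ballP; exists (eps / 2) => //= z yz.
by rewrite [eps]splitr; exact: ball_triangle (ball_sym yu) yz.
Qed.

(** A sequence [z] codes a limit of the centres [u (z k)] if their balls pairwise meet, and [y0]
    otherwise. In the first case [h z] is in an open [U] iff some ball of radius [3 * e k] around
    [u (z k)] is contained in [U], a condition on single coordinates. *)
Lemma polish_decoding (u : nat -> Y) (y0 : Y) : exists h : baire -> Y,
  (forall U, open U -> measurable [set z | U (h z)]) /\
  (forall (z : baire) y, (forall k, ball (u (z k)) (e k) y) ->
     forall k, ball (u (z k)) (3 * e k) (h z)).
Proof.
pose K (z : baire) := forall k l,
  exists w, ball (u (z k)) (e k) w /\ ball (u (z l)) (e l) w.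
have /choice[h hP] : forall z : baire, exists y,
    (K z /\ forall k, ball (u (z k)) (3 * e k) y) \/ (~ K z /\ y = y0).
  move=> z; have [Kz|nK] := pselect (K z); last by exists y0; right.
  by have [y yP] := @pairwise_meeting_limit (u \o z) Kz; exists y; left.
have mK : measurable [set z | K z].
  apply: measurable_Pforall => // k; apply: measurable_Pforall => // l.
  rewrite (_ : [set z | _] = [set z : baire | exists n, z k = n /\
      exists w, ball (u n) (e k) w /\ ball (u (z l)) (e l) w]).
    apply: measurable_Pexists => // n; apply: measurable_Pand.
      exact: (measurable_baire_coord k (fun m => m = n)).
    exact: (measurable_baire_coord l
      (fun m => exists w, ball (u n) (e k) w /\ ball (u m) (e l) w)).
  by apply/seteqP; split=> z /= => [?|[n [-> //]]]; exists (z k).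
exists h; split=> [U oU|z y zy k]; last first.
  by case: (hP z) => [[_ H]|[nK _]]; [exact: H|case: nK => i j; exists y].
rewrite (_ : [set z | _] =
  [set z | (K z /\ exists k, ball (u (z k)) (3 * e k) `<=` U) \/ (~ K z /\ U y0)]).
  apply: measurable_Por; apply: measurable_Pand => //.
  - apply: measurable_Pexists => // k.
    exact: (measurable_baire_coord k (fun m => ball (u m) (3 * e k) `<=` U)).
  - exact: measurable_Pnot.
  - exact: measurable_Pcst.
apply/seteqP; split=> z /=; case: (hP z) => [[Kz hz]|[nK ->]].
- move=> Uhz; left; split=> //.
  have /nbhs_ballP[eps /= eps0 epsU] : nbhs (h z) U by exact: open_nbhs_nbhs.
  (* Two radii [3 * e k] have to fit into [eps]. *)
  have [|k ek] := @e_small (eps / 6); first by rewrite divr_gt0.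
  exists k => w uw; apply: epsU; apply: (le_ball (e1 := 3 * e k + 3 * e k)).
    by lra.
  exact: ball_triangle (ball_sym (hz k)) uw.
- by move=> Uy0; right.
- by case=> [[_ [k kU]]|[]//]; exact/kU/hz.
- by case=> [[]//|[]].
Qed.

End PolishCoding.

(** The code of [x] lists, for each [k], the first dense point whose [e k]-ball has [f x] in its
    interior. A retraction is enough later on: the codes are the fixed points of [i \o h], a Borel
    set. *)
Lemma standard_borel_retract (R : realType) (d : measure_display)
    (X : measurableType d) (x0 : X) : standard_borel R X ->
  exists (i : X -> baire) (h : baire -> X),
    [/\ measurable_fun setT i, measurable_fun setT h & cancel i h].
Proof.
move=> [Y [[hausY [S cS dS]] [f [[f' fK f'K] fM]]]].
have [u Su] := countable_range (f x0) cS.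
have du : dense (range u).
  by move=> O O0 oO; have [y [Oy /Su Sy]] := dS O O0 oO; exists y.
have [h [hM hP]] := polish_decoding u (f x0).
pose e (k : nat) : R := (k.+1%:R^-1)%R.
have e_gt0 k : (0 < e k)%R by rewrite /e Num.Theory.invr_gt0.
have /choice[i iP] : forall k, exists n : X -> nat,
    (forall x, (exists j, (ball (u j) (e k))^° (f x)) ->
       (ball (u (n x)) (e k))^° (f x)) /\
    forall j, measurable [set x | n x = j].
  move=> k; apply: measurable_least => j.
  apply: (fM (ball (u j) (e k))^°).2; apply: sub_sigma_algebra.
  exact: open_interior.
exists (fun x k => i k x), (f' \o h); split.
- by apply/measurable_fun_baire => k j; exact: (iP k).2.
- move=> _ M mM; rewrite setTI.
  suff : <<s @open Y >> `<=` [set A : set Y | measurable [set z | A (h z)]].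
    move/(_ [set y | M (f' y)]); apply; apply/fM.
    rewrite (_ : _ @^-1` _ = M) //.
    by apply/seteqP; split=> x; rewrite /= fK.
  apply: smallest_sub; last by move=> U; exact: hM.
  split=> /= [|A mA|A mA].
  + exact: measurable_Pcst.
  + rewrite (_ : [set z | _] = [set z | ~ A (h z)]); first exact: measurable_Pnot.
    by apply/seteqP; split=> z /= => [[]|].
  + rewrite (_ : [set z | _] = [set z | exists n, A n (h z)]).
      exact: measurable_Pexists.
    by apply/seteqP; split=> z /= [n] => [_ ?|?]; exists n.
- move=> x /=; rewrite -[RHS]fK; congr f'.
  have xi k : (ball (u (i k x)) (e k))^° (f x).
    by apply: (iP k).1; exact: dense_interior_cover.
  have xb k : ball (u (i k x)) (e k) (f x) by exact: (interior_subset (xi k)).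
  rewrite -(closeE hausY) ball_close => eps.
  have eps4 : (0 < eps%:num / 4)%R by rewrite Num.Theory.divr_gt0.
  have [N _ NP] := near_infty_natSinv_lt (PosNum eps4).
  have ek : (e N < eps%:num / 4)%R := NP N (leqnn N).
  apply: (le_ball (e1 := (3 * e N + e N)%R)); first by lra.
  exact: ball_triangle (ball_sym (hP (fun k => i k x) _ xb N)) (xb N).
Qed.

(** * Countable Borel equivalence relations and their quotient actions *)

Lemma measurable_standard_borel_eq (R : realType) (d : measure_display)
    (X : measurableType d) (u v : X -> X) : standard_borel R X ->
  measurable_fun setT u -> measurable_fun setT v ->
  measurable [set x | u x = v x].
Proof.
move=> sX mu mv.
have [[x0 _]|X0] := pselect (exists x : X, True); last first.
  rewrite (_ : [set x | _] = set0) //; apply/seteqP; split=> // x.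
  by case: X0; exists x.
have [i [h [mi mh ih]]] := standard_borel_retract x0 sX.
rewrite (_ : [set x | _] = [set x | (i \o u) x = (i \o v) x]).
  by apply: measurable_baire_eq; exact: measurableT_comp.
by apply/seteqP; split=> x /= => [->//|]; exact: (can_inj ih).
Qed.

Lemma measurable_rel (d : measure_display) (X : measurableType d)
    (E : X -> X -> Prop) (d' : measure_display) (T : measurableType d')
    (u v : T -> X) : measurable [set p : X * X | E p.1 p.2] ->
  measurable_fun setT u -> measurable_fun setT v ->
  measurable [set x | E (u x) (v x)].
Proof.
move=> mE mu mv.
exact: (measurable_preimageT (A := fun p => E p.1 p.2)
  (measurable_fun_pair mu mv) mE).
Qed.

(** Lusin-Novikov is applied to the copy of [E] on codes, the fixed points of [i \o h]; there [h] is
    injective, so sections stay countable. *)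
Theorem cber_enumeration (R : realType) (d : measure_display)
    (X : measurableType d) (E : X -> X -> Prop) : standard_borel R X -> cber E ->
  exists f : nat -> X -> X, [/\ forall n, measurable_fun setT (f n),
    forall n x, E x (f n x) & forall x y, E x y -> exists n, y = f n x].
Proof.
move=> sX [Er Es Et mE cE].
have [[x0 _]|X0] := pselect (exists x : X, True); last first.
  by exists (fun _ => id); split=> // x; case: X0; exists x.
have [i [h [mi mh ih]]] := standard_borel_retract x0 sX.
pose A := [set p : baire * baire |
  (i (h p.1) = p.1 /\ i (h p.2) = p.2) /\ E (h p.1) (h p.2)].
have [||g [mg gA]] := @Lusin_Novikov A.
- have mh1 : measurable_fun setT (h \o fst : baire * baire -> X).
    exact: (measurableT_comp mh measurable_fst).
  have mh2 : measurable_fun setT (h \o snd : baire * baire -> X).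
    exact: (measurableT_comp mh measurable_snd).
  apply: measurable_Pand; last exact: measurable_rel mh1 mh2.
  apply: measurable_Pand; apply: measurable_baire_eq.
  + exact: (measurableT_comp mi mh1).
  + exact: measurable_fst.
  + exact: (measurableT_comp mi mh2).
  + exact: measurable_snd.
- move=> x; have /countable_injP[c cinj] := cE (h x).
  apply/countable_injP; exists (c \o h) => y z; rewrite !inE /A /=.
  move=> [[_ iy] Ey] [[_ iz] Ez] /cinj; rewrite !inE => /(_ Ey Ez) yz.
  by rewrite -iy -iz yz.
pose f n x := h (g n (i x)).
have mf n : measurable_fun setT (f n).
  exact: (measurableT_comp mh (measurableT_comp (mg n) mi)).
(* Where [f n x] leaves the class of [x], it is replaced by [x]. *)
exists (fun n x => if `[< E x (f n x) >] then f n x else x); split=> [n|n x|x y Exy].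
- apply: (@measurable_fun_piecewise _ _ _ _ bool
    (fun b x => if b then E x (f n x) else ~ E x (f n x))
    (fun b => if b then f n else id)) => //.
  + by case=> /=; [|apply: measurable_Pnot]; apply: measurable_rel.
  + by case.
  + by move=> x; have [?|?] := pselect (E x (f n x)); [exists true|exists false].
  + by case=> x /= H; [rewrite asboolT|rewrite asboolF].
- by case: ifPn => // /asboolP.
- have [|n yn] := gA (i x) (i y); first by rewrite /A /= !ih.
  by exists n; rewrite /f -yn ih asboolT.
Qed.

(** * Construction of the lift from Borel maps enumerating [E] and inducing the action *)

Section ClassBijectiveLift.
Context (d : measure_display) (X : measurableType d) (E : X -> X -> Prop).
Context (f : nat -> X -> X) (T : X -> X).
Context (G : groupType) (a : G -> equot E -> equot E) (t : G -> X -> X).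
Context (idx : G -> nat).
Hypothesis E_cber : cber E.
Hypothesis meq : forall u v : X -> X, measurable_fun setT u ->
  measurable_fun setT v -> measurable [set x | u x = v x].
Hypothesis mf : forall n, measurable_fun setT (f n).
Hypothesis fP : forall x y, E x y -> exists n, y = f n x.
Hypothesis Ef : forall n x, E x (f n x).
Hypothesis mT : measurable_fun setT T.
Hypothesis T_inj : injective T.
Hypothesis T_proper : forall x, T @` eclass E x `<` eclass E x.
Hypothesis a_action : group_action a.
Hypothesis mt : forall g, measurable_fun setT (t g).
Hypothesis tP : forall g x, a g (to_equot E x) = to_equot E (t g x).
Hypothesis idx_inj : injective idx.
Hypothesis idx1 : idx 1%g = 0%N.

Local Notation "[ x ]_E" := (to_equot E x) (at level 0, format "[ x ]_E").

Let Er := cber_refl E_cber.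
Let Es := cber_sym E_cber.
Let Et := cber_trans E_cber.

Lemma to_equotP x y : [x]_E = [y]_E <-> E x y.
Proof.
split=> [/(congr1 sval) /= xy|xy].
  by have : eclass E y y := Er y; rewrite -xy.
apply: eq_exist => /=; apply/seteqP; split=> z.
  by apply: Et; exact: Es.
exact: Et.
Qed.

Let mE (u v : X -> X) : measurable_fun setT u -> measurable_fun setT v ->
  measurable [set x | E (u x) (v x)].
Proof. exact: (measurable_rel (cber_borel E_cber)). Qed.

Let cG : countable [set: G].
Proof. by apply/countable_injP; exists idx => ? ? _ _ /idx_inj. Qed.

Let aK g x y : a g [x]_E = a g [y]_E -> [x]_E = [y]_E.
Proof.
move=> /(congr1 (a g^-1%g)); rewrite -!a_action.2 mulVg.
by rewrite !a_action.1.
Qed.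

Let t_inv g x y : E (t g x) y -> E (t g^-1%g y) x.
Proof.
move=> /to_equotP gxy; apply/to_equotP.
by rewrite -tP -gxy -tP -a_action.2 mulVg a_action.1.
Qed.

Let E_T x : E x (T x).
Proof. by have [+ _] := T_proper x; apply; exists x => //; exact: Er. Qed.

Let ET_iter n x : E x (iter n T x).
Proof. by elim: n => [|n IH] /=; [exact: Er|exact: Et IH (E_T _)]. Qed.

Let mT_iter n : measurable_fun setT (iter n T).
Proof.
elim: n => [|n IH]; first exact: measurable_id.
exact: (measurableT_comp mT IH).
Qed.

(** Points outside the range of [T] have pairwise disjoint forward orbits without repetitions; these
    orbits are the room used by [Phi]. *)
Let T_iter_inj m n x y : (forall w, T w <> x) -> (forall w, T w <> y) ->
  iter m T x = iter n T y -> m = n /\ x = y.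
Proof.
move=> Tx Ty; elim: m n => [|m IH] [|n] //=.
- by move=> /esym /Tx.
- by move=> /Ty.
- by move=> /T_inj /IH[-> ->].
Qed.

(** [A] is the complement of the range of [T], Borel because a [T]-preimage of [x] lies in the class
    of [x] and hence is some [f j x]. By compressibility [A] meets each class, and [r] picks the
    first such point. *)
Let retraction_ex : exists r : X -> X,
  [/\ measurable_fun setT r, forall x, E x (r x) & forall x w, T w <> r x].
Proof.
pose A x := forall j, T (f j x) <> x.
have mA : measurable [set x | A x].
  apply: measurable_Pforall => // j; apply/measurable_Pnot/meq => //.
  exact: (measurableT_comp mT (mf j)).
have AT x w : A x -> T w <> x.
  move=> Ax wx; have /Es/fP[j wj] : E w x by rewrite -wx; exact: E_T.
  by apply: (Ax j); rewrite -wj.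
have [n [nP mn]] : exists n : X -> nat,
    (forall x, (exists m, A (f m x)) -> A (f (n x) x)) /\
    forall m, measurable [set x | n x = m].
  by apply: (measurable_least (P := fun m x => A (f m x))) => m;
    exact: measurable_preimageT (mf m) mA.
exists (fun x => f (n x) x); split=> // [|x w].
  by apply: (@measurable_fun_piecewise _ _ _ _ nat (fun m x => n x = m) f) => //;
    [move=> x; exists (n x)|move=> i x ->].
apply: AT; apply: nP; have [_ nsub] := T_proper x.
apply: contrapT => nex; apply: nsub => y Exy.
have [m ym] := fP Exy.
apply: contrapT => nTy; apply: nex; exists m; rewrite -ym => j jy; apply: nTy.
exists (f j y) => //; exact: Et Exy (Ef j y).
Qed.

(* [Phi g z] lies in the class [g[z]] and determines [(g, z)]: this is where
   compressibility provides the room inside each class *)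
Let Phi_ex : exists Phi : G -> X -> X,
  [/\ forall g, measurable_fun setT (Phi g), forall g z, E (t g z) (Phi g z) &
      forall g h z w, Phi g z = Phi h w -> g = h /\ z = w].
Proof.
have [r [mr Exr Tr]] := retraction_ex.
(* [r (t g z)] determines [z] up to countably many candidates; [l g z] is the index of the right
   one. *)
have /choice[l lP] : forall g, exists n : X -> nat,
    (forall z, (exists j, f j (t g^-1%g (r (t g z))) = z) ->
      f (n z) (t g^-1%g (r (t g z))) = z) /\
    forall j, measurable [set z | n z = j].
  move=> g.
  apply: (measurable_least (P := fun j z => f j (t g^-1%g (r (t g z))) = z)) => j.
  apply: meq => //.
  exact: (measurableT_comp (mf j) (measurableT_comp (mt _)
    (measurableT_comp mr (mt g)))).
have lK g z : f (l g z) (t g^-1%g (r (t g z))) = z.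
  by apply: (lP g).1; have [j zj] := fP (t_inv (Exr (t g z))); exists j.
(* The number of applications of [T] records both [g] and the index; it can be read back since the
   starting point is outside the range of [T]. *)
pose code (g : G) (j : nat) : nat := choice.pickle (idx g, j).
exists (fun g z => iter (code g (l g z)) T (r (t g z))); split.
- move=> g; apply: (@measurable_fun_piecewise _ _ _ _ nat (fun j z => l g z = j)
    (fun j z => iter (code g j) T (r (t g z)))) => //.
  + exact: (lP g).2.
  + by move=> j; exact: (measurableT_comp (mT_iter _) (measurableT_comp mr (mt g))).
  + by move=> z; exists (l g z).
  + by move=> j z <-.
- by move=> g z; exact: Et (Exr _) (ET_iter _ _).
- move=> g h z w /T_iter_inj[||/(pcan_inj choice.pickleK)[/idx_inj gh lE] rE];
    try exact: Tr.
  by split=> //; rewrite -(lK g z) -(lK h w) lE rE gh.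
Qed.

Lemma class_bijective_lift_exists : exists b : G -> X -> X,
  class_bijective_lift a b.
Proof.
have [Phi [mPhi EPhi Phi_inj]] := Phi_ex.
pose W g z := forall h, a h [z]_E = a g [z]_E -> (idx g <= idx h)%N.
have mW g : measurable [set z | W g z].
  apply: measurable_Pforall => // h.
  rewrite (_ : [set z | _] =
      [set z | ~ E (t h z) (t g z) \/ (idx g <= idx h)%N]).
    apply: measurable_Por; last exact: measurable_Pcst.
    by apply/measurable_Pnot/mE.
  apply/seteqP; split=> z /=; rewrite !tP to_equotP; last by case.
  by move=> H; have [/H|] := pselect (E (t h z) (t g z)); [right|left].
have W_ex g z : exists k, W k z /\ a k [z]_E = a g [z]_E.
  pose P n := `[< exists k, idx k = n /\ a k [z]_E = a g [z]_E >].
  have exP : exists n, P n by exists (idx g); apply/asboolP; exists g.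
  case: (ex_minnP exP) => n /asboolP[k [kn kg]] nmin.
  exists k; split=> // h hk; rewrite kn; apply: nmin; apply/asboolP.
  by exists h; rewrite -kg.
have W_uniq g h z : W g z -> W h z -> a g [z]_E = a h [z]_E -> g = h.
  by move=> Wg Wh gh; apply/idx_inj/eqP; rewrite eqn_leq Wg ?Wh.
(* Here it matters that the identity comes first: every pair [(1, z)] is in [W]. *)
have W1 z : W 1%g z by move=> h _; rewrite idx1.
(* A point of [g[z]] leaves countably many candidates for [z], which turns quantifiers over [z] into
   countable ones. *)
have decode g z y : E (t g z) y -> exists l, z = f l (t g^-1%g y).
  by move=> /t_inv/fP.
have mdecode g l : measurable_fun setT (fun y => f l (t g^-1%g y)).
  exact: (measurableT_comp (mf l) (mt _)).
(* Schroeder-Bernstein for [Phi] and [x |-> (1, x)] *)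
pose Sn := fix Sn n y := if n is m.+1 then exists z, Sn m z /\ Phi 1%g z = y
  else exists h z, [/\ h <> 1%g, W h z & Phi h z = y].
pose S y := exists n, Sn n y.
have mS : measurable [set y | S y].
  apply: measurable_Pexists => //; elim=> [|n IH] /=.
    rewrite (_ : [set y | _] = [set y | exists h, exists l, h <> 1%g /\
        (W h (f l (t h^-1%g y)) /\ Phi h (f l (t h^-1%g y)) = y)]).
      apply: measurable_Pexists => // h; apply: measurable_Pexists => // l.
      apply: measurable_Pand; first exact: measurable_Pcst.
      apply: measurable_Pand; first exact: measurable_preimageT (mdecode h l) (mW h).
      by apply: meq => //; exact: (measurableT_comp (mPhi h) (mdecode h l)).
    apply/seteqP; split=> y /=.
      move=> [h [z [h1 Wz zy]]]; have [|l zl] := @decode h z y.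
        by rewrite -zy; exact: EPhi.
      by exists h, l; rewrite -zl.
    by move=> [h [l [h1 [Wz zy]]]]; exists h, (f l (t h^-1%g y)).
  rewrite (_ : [set y | _] = [set y | exists l, Sn n (f l (t 1^-1%g y)) /\
      Phi 1%g (f l (t 1^-1%g y)) = y]).
    apply: measurable_Pexists => // l; apply: measurable_Pand.
      exact: measurable_preimageT (mdecode 1%g l) IH.
    by apply: meq => //; exact: (measurableT_comp (mPhi _) (mdecode 1%g l)).
  apply/seteqP; split=> y /=.
    move=> [z [Sz zy]]; have [|l zl] := @decode 1%g z y.
      by rewrite -zy; exact: EPhi.
    by exists l; rewrite -zl.
  by move=> [l [Sz zy]]; exists (f l (t 1^-1%g y)).
(* [S] consists of the points whose backward chain stops at a pair [(h, z)] with [h] not the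
   identity, outside the image of [x |-> (1, x)]. [beta] follows [Phi] on such chains and inverts
   that embedding elsewhere. *)
pose beta h z := if `[< h <> 1%g \/ S z >] then Phi h z else z.
have mbeta h : measurable_fun setT (beta h).
  apply: (@measurable_fun_piecewise _ _ _ _ bool
    (fun b z => if b then h <> 1%g \/ S z else ~ (h <> 1%g \/ S z))
    (fun b => if b then Phi h else id)) => //.
  + case=> /=; [|apply: measurable_Pnot];
      by apply: measurable_Por => //; exact: measurable_Pcst.
  + by case.
  + by move=> x; have [?|?] := pselect (h <> 1%g \/ S x); [exists true|exists false].
  + by case=> x /= H; rewrite /beta; [rewrite asboolT|rewrite asboolF].
have betaE h z : a h [z]_E = [beta h z]_E.
  rewrite /beta; case: ifPn => [_|/asboolP/not_orP[/contrapT -> _]].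
    by rewrite tP; apply/to_equotP; exact: EPhi.
  by rewrite a_action.1.
have beta_inj h k z w : W h z -> W k w -> beta h z = beta k w -> h = k /\ z = w.
  have SPhi g x : W g x -> g <> 1%g \/ S x -> S (Phi g x).
    have [-> _ [//|[n Sx]]|/eqP g1 Wx _] := eqVneq g 1%g.
      by exists n.+1, x.
    by exists 0%N, g, x.
  move=> Wz Ww; rewrite /beta.
  case: ifPn => [/asboolP Hz|/asboolP Hz]; case: ifPn => [/asboolP Hw|/asboolP Hw].
  - exact: Phi_inj.
  - by move=> zw; case: Hw; right; rewrite -zw; exact: SPhi.
  - by move=> zw; case: Hz; right; rewrite zw; exact: SPhi.
  - by move: Hz Hw => /not_orP[/contrapT -> _] /not_orP[/contrapT -> _] ->.
have beta_surj x : exists h z, W h z /\ beta h z = x.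
  have [[[|n] /=]|nS] := pselect (S x).
  - move=> [h [z [h1 Wz zx]]]; exists h, z; split=> //.
    by rewrite /beta asboolT//; left.
  - move=> [z [Sz zx]]; exists 1%g, z; split=> //.
    by rewrite /beta asboolT//; right; exists n.
  - by exists 1%g, x; split=> //; rewrite /beta asboolF// => -[].
(* The value is independent of [(h, z, k)]: the pair is unique by [beta_inj], and [k] by
   [W_uniq]. *)
have /choice[b bP] : forall gx : G * X, exists y, forall h z k, W h z ->
    beta h z = gx.2 -> W k z -> a k [z]_E = a (gx.1 * h)%g [z]_E -> y = beta k z.
  move=> [g x] /=; have [h [z [Wz zx]]] := beta_surj x.
  have [k [Wk kE]] := W_ex (g * h)%g z; exists (beta k z).
  move=> h' z' k' Wz' zx' Wk' kE'.
  have [hh zz] : h' = h /\ z' = z by apply: beta_inj => //; rewrite zx zx'.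
  rewrite zz in Wk' kE' *; rewrite hh in kE'.
  by congr beta; apply: (W_uniq _ _ z) => //; rewrite kE kE'.
exists (fun g x => b (g, x)).
have bE g h z k : W h z -> W k z -> a k [z]_E = a (g * h)%g [z]_E ->
    b (g, beta h z) = beta k z.
  by move=> Wz Wk kE; exact: (bP (g, beta h z) h z k).
have b1 x : b (1%g, x) = x.
  by have [h [z [Wz <-]]] := beta_surj x; apply: bE => //; rewrite mul1g.
have bM g h x : b ((g * h)%g, x) = b (g, b (h, x)).
  have [l [z [Wz <-]]] := beta_surj x.
  have [k [Wk kE]] := W_ex (h * l)%g z.
  have [k' [Wk' k'E]] := W_ex (g * k)%g z.
  rewrite (bE h l z k)// (bE g k z k')//; apply: bE => //.
  by rewrite k'E -mulgA !(a_action.2 g) kE.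
have b_lift g x : [b (g, x)]_E = a g [x]_E.
  have [h [z [Wz <-]]] := beta_surj x; have [k [Wk kE]] := W_ex (g * h)%g z.
  by rewrite (bE g h z k)// -!betaE kE a_action.2.
split=> // [g|g x].
- split.
  (* On the piece [(h, l, k)], [x] is [beta h z] with [z] its [l]-th candidate, and [k] is the first
     element carrying [z] to the target class. *)
  + apply: (@measurable_fun_piecewise _ _ _ _ (G * nat * G)%type
      (fun i x => let z := f i.1.2 (t i.1.1^-1%g x) in
         (W i.1.1 z /\ beta i.1.1 z = x) /\
         (W i.2 z /\ E (t i.2 z) (t (g * i.1.1)%g z)))
      (fun i x => beta i.2 (f i.1.2 (t i.1.1^-1%g x)))).
    * apply/countable_injP.
      exists (fun i => choice.pickle (idx i.1.1, i.1.2, idx i.2)).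
      move=> [[h l] k] [[h' l'] k'] _ _ /(pcan_inj choice.pickleK) /=.
      by move=> [/idx_inj -> -> /idx_inj ->].
    * move=> [[h l] k] /=; have mz := mdecode h l.
      apply: measurable_Pand; apply: measurable_Pand.
      - exact: measurable_preimageT mz (mW h).
      - by apply: meq => //; exact: (measurableT_comp (mbeta h) mz).
      - exact: measurable_preimageT mz (mW k).
      - by apply: mE; exact: (measurableT_comp (mt _) mz).
    * by move=> [[h l] k]; exact: (measurableT_comp (mbeta k) (mdecode h l)).
    * move=> x; have [h [z [Wz zx]]] := beta_surj x.
      have [k [Wk kE]] := W_ex (g * h)%g z.
      have [|l zl] := @decode h z x.
        by apply/to_equotP; rewrite -tP betaE zx.
      by exists (h, l, k) => /=; rewrite -zl; do 2 split=> //;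
        apply/to_equotP; rewrite -!tP.
    * move=> [[h l] k] x /= [[Wz zx] [Wk kE]]; rewrite -{1}zx; apply: bE => //.
      by rewrite !tP; exact/to_equotP.
  + exists (fun x => b (g^-1%g, x)) => x; rewrite -bM ?mulVg ?mulgV; exact: b1.
  + move=> x y; rewrite -!to_equotP !b_lift; split=> [->//|]; exact: aK.
- have [h [z [Wz <-]]] := beta_surj x; have [k [Wk kE]] := W_ex (g * h)%g z.
  rewrite (bE g h z k)// => /to_equotP; rewrite -!betaE => kh.
  by congr beta; exact: W_uniq Wk Wz kh.
Qed.

End ClassBijectiveLift.

Theorem theorem3p5 (R : realType) (d : measure_display) (X : measurableType d)
    (E : X -> X -> Prop) (G : groupType) (a : G -> equot E -> equot E)
    (X_standard : standard_borel R X)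
    (E_cber : cber E)
    (E_compressible : compressible E)
    (G_countable : countable [set: G])
    (a_action : borel_quot_action a) :
  exists b : G -> X -> X, class_bijective_lift a b.
Proof.
have [f [mf Ef fP]] := cber_enumeration X_standard E_cber.
have [T [mT T_inj T_proper]] := E_compressible.
have [act a_borel] := a_action.
have /choice[t tP] : forall g, exists t : X -> X, measurable_fun setT t /\
    forall x, a g (to_equot E x) = to_equot E (t x).
  by move=> g; have [[t mt tE] _] := a_borel g; exists t.
have /countable_injP[c cinj] := G_countable.
(* The shift by one reserves index 0 for the identity. *)
pose idx g := if g == 1%g then 0%N else (c g).+1.
apply: (@class_bijective_lift_exists _ _ _ f T G a t idx) => //.
- by move=> u v; exact: measurable_standard_borel_eq X_standard.
- by move=> g; exact: (tP g).1.
- by move=> g; exact: (tP g).2.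
- move=> g h; rewrite /idx; case: eqVneq => [->|_]; case: eqVneq => [->|_] //.
  by move=> [] /cinj; rewrite !inE; exact.
- by rewrite /idx eqxx.
Qed.
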